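(* Let $M \subseteq \mathbb{R}^2$ be non-empty. If $h(M) \ne 4$, then $r(M) = h(M) + 1$. If $h(M) = 4$, then $r(M) \in \{5, 6\}$.
   Context: For a non-empty set $M \subseteq \mathbb{R}^2$, a subset $C \subseteq M$ is called $M$-convex if $C = M \cap K$ for some convex set $K \subseteq \mathbb{R}^2$ (the empty set is $M$-convex). Helly number: $h(M)$ is the minimal integer $h \ge 0$ such that every finite collection $C_1,\ldots,C_m$ ($m \ge h$) of $M$-convex sets, for which every sub-collection of $h$ elements has non-empty intersection, satisfies $C_1 \cap \cdots \cap C_m \ne \emptyset$ (collections are indexed families; the intersection of the empty sub-collection is $M$); $h(M) := \infty$ if no such $h$ exists. Radon number: $r(M)$ is the minimal $r$ such that for every $A \subseteq M$ with $|A| \ge r$ there exist disjoint sets $B, C \subseteq A$ with $M \cap \mathrm{conv}\, B \cap \mathrm{conv}\, C \ne \emptyset$, where $\mathrm{conv}$ denotes the convex hull; $r(M) := \infty$ if no such $r$ exists. Convention: $\infty + 1 = \infty$. *)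

(* Defs.v *)
From HB Require Import structures.
From mathcomp Require Import all_boot all_order all_algebra.
From mathcomp Require Import all_classical all_reals convex.
Set Implicit Arguments.
Unset Strict Implicit.
Unset Printing Implicit Defensive.
Import Order.TTheory GRing.Theory Num.Theory.
Local Open Scope classical_set_scope.
Local Open Scope card_scope.

(* The least natural number satisfying P, where None stands for infinity:
   it is the value when no number satisfies P. Accordingly omap succn is
   the map n |-> n + 1 extended by infinity + 1 = infinity. *)
Definition nat_min (P : nat -> Prop) : option nat :=
  if pselect (exists n, `[< P n >]) is left e then Some (ex_minn e) else None.

Lemma nat_minP (P : nat -> Prop) (n : nat) :
  nat_min P = Some n <-> P n /\ (forall m, P m -> n <= m).
Proof.
rewrite /nat_min; case: pselect => [e|ne]; last first.
  by split=> // -[Pn _]; case: ne; exists n; apply/asboolP.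
case: ex_minnP => k /asboolP Pk kmin; split=> [[<-]|[Pn nmin]].
  by split=> // m /asboolP; apply: kmin.
congr Some; apply/eqP; rewrite eqn_leq nmin // andbT.
by apply: kmin; apply/asboolP.
Qed.

Lemma nat_min_None (P : nat -> Prop) :
  nat_min P = None <-> forall n, ~ P n.
Proof.
rewrite /nat_min; case: pselect => [e|ne]; split=> //.
- by move=> nP; exfalso; case: e => n /asboolP /nP.
- by move=> _ n Pn; apply: ne; exists n; apply/asboolP.
Qed.

Section HellyRadon.
Context {R : realType}.
Implicit Types M A B C K : set 'rV[R]_2.

Definition M_convex M C : Prop :=
  exists K, @convex_set R 'rV[R]_2 K /\ C = M `&` K.

Definition convex_hull A : set 'rV[R]_2 :=
  smallest (@convex_set R 'rV[R]_2) A.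

(* Intersecting with M only matters for the empty subfamily, whose
   intersection is M. *)
Definition helly_property M (h : nat) : Prop :=
  forall (m : nat) (C : 'I_m -> set 'rV[R]_2),
    h <= m ->
    (forall i, M_convex M (C i)) ->
    (forall J : {set 'I_m}, #|J| = h ->
       M `&` \bigcap_(i in [set i | i \in J]) C i !=set0) ->
    M `&` \bigcap_(i in [set: 'I_m]) C i !=set0.

Definition helly_number M : option nat := nat_min (helly_property M).

(* `I_r #<= A says that A, possibly infinite, has at least r elements. *)
Definition radon_property M (r : nat) : Prop :=
  forall A, A `<=` M -> `I_r #<= A ->
    exists B C, [/\ B `<=` A, C `<=` A, B `&` C = set0 &
      M `&` convex_hull B `&` convex_hull C !=set0].

Definition radon_number M : option nat := nat_min (radon_property M).

End HellyRadon.

(* Main.v *)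
Require Import Defs.
From mathcomp Require Import all_boot all_order all_algebra.
From mathcomp Require Import all_classical all_reals.
From mathcomp Require Import interval_inference convex.
From mathcomp Require Import ring lra.
Import Order.TTheory GRing.Theory Num.Theory.

(* Levi's argument gives h(M) + 1 <= r(M). Conversely, let A be a set of
   h + 1 <> 5 points of M; the Helly property applied to the sets
   M /\ conv (A \ {a}) yields a point p of M lying in conv (A \ {a}) for every
   a in A, and it suffices to find disjoint B, C in A with p in both hulls.
   If p is still in conv (A \ {a, b}) for all a and b, take for B a
   Caratheodory triple around p and C = A \ B. Otherwise some line through p
   has all of A but two points a, b strictly on one side; sorting the points by
   their slopes seen from p, one can pair up the two extreme and the two next
   to extreme points of A \ {a, b} with a and b. This needs |A| - 2 <> 3, since
   three points would make the middle one serve in both triangles. *)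

(** * Linear functionals on the plane *)

Section PlaneVectors.
Set Implicit Arguments.
Unset Strict Implicit.
Local Open Scope ring_scope.
Context {R : realType}.
Implicit Types u w x : 'rV[R]_2.

Definition dot w x : R := w 0 0 * x 0 0 + w 0 1 * x 0 1.

Definition perp x : 'rV[R]_2 := \row_j (if j == 0 then - x 0 1 else x 0 0).

Lemma row2P u w : u 0 0 = w 0 0 -> u 0 1 = w 0 1 -> u = w.
Proof.
move=> e0 e1; apply/rowP => j.
by have [->|->] : j = 0 \/ j = 1 by case: j => -[|[|//]] ?; [left|right]; apply: val_inj.
Qed.

Lemma dotDl u w x : dot (u + w) x = dot u x + dot w x.
Proof. by rewrite /dot !mxE; ring. Qed.

Lemma dotNl w x : dot (- w) x = - dot w x.
Proof. by rewrite /dot !mxE; ring. Qed.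

Lemma dotZl (c : R) w x : dot (c *: w) x = c * dot w x.
Proof. by rewrite /dot !mxE; ring. Qed.

Lemma dotDr w x u : dot w (x + u) = dot w x + dot w u.
Proof. by rewrite /dot !mxE; ring. Qed.

Lemma dotZr w (c : R) x : dot w (c *: x) = c * dot w x.
Proof. by rewrite /dot !mxE; ring. Qed.

Lemma dot0r w : dot w 0 = 0.
Proof. by rewrite /dot !mxE; ring. Qed.

Lemma dot_perp w x : dot (perp w) x = w 0 0 * x 0 1 - w 0 1 * x 0 0.
Proof. by rewrite /dot !mxE /=; ring. Qed.

Lemma dot_self_gt0 x : x != 0 -> 0 < dot x x.
Proof.
move=> x0; rewrite /dot -!expr2 lt_neqAle addr_ge0 ?sqr_ge0 // andbT.
apply: contraNN x0; rewrite eq_sym paddr_eq0 ?sqr_ge0 // !sqrf_eq0.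
by move=> /andP[/eqP x0 /eqP x1]; apply/eqP/row2P; rewrite mxE.
Qed.

(** [w] and [perp w] are orthogonal of equal length. Factoring out [dot w x] makes the value of [u]
    an affine function of a slope. *)
Lemma dot_decomp u w x :
  dot u x * dot w w = dot u w * dot w x + dot u (perp w) * dot (perp w) x.
Proof. by rewrite dot_perp /dot !mxE /=; ring. Qed.

(** * Gordan's alternative for a finite family of vectors *)

Section Family.
Context {T : finType} (v : T -> 'rV[R]_2).
Implicit Types S X Y B C : {set T}.

(* By Gordan's theorem, [~ pos S] says that 0 is in the convex hull of [v @: S]. *)
Definition pos S := exists w, forall i, i \in S -> 0 < dot w (v i).

Lemma pos_sub S X : S \subset X -> pos X -> pos S.
Proof. by move=> /fintype.subsetP SX [w wX]; exists w => i /SX /wX. Qed.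

(** Supplies the step size for perturbing a functional without losing finitely many strict
    inequalities. *)
Lemma small_scaling S (F G : T -> R) : (forall i, i \in S -> 0 < F i) ->
  exists2 e, 0 < e & forall i, i \in S -> e * G i < F i.
Proof.
move=> F0; suff [e e0 eP] : exists2 e, 0 < e &
    forall i, i \in enum S -> e * G i < F i.
  by exists e => // i; rewrite -mem_enum; apply: eP.
have : forall i, i \in enum S -> 0 < F i by move=> i; rewrite mem_enum; apply: F0.
elim: (enum S) => [|j s IHs] {}F0; first by exists 1.
have [|e e0 eP] := IHs; first by move=> i si; apply: F0; rewrite inE si orbT.
have Fj : 0 < F j by apply: F0; rewrite inE eqxx.
have Gj : 0 < 1 + `|G j| by rewrite ltr_pwDl.
have dG : 0 < F j / (1 + `|G j|) by rewrite divr_gt0.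
exists (Num.min e (F j / (1 + `|G j|))); first by rewrite lt_min e0.
set d := Num.min _ _.
have d0 : 0 < d by rewrite lt_min e0.
have dle : d <= e by rewrite ge_min lexx.
have dle' : d * (1 + `|G j|) <= F j by rewrite -ler_pdivlMr // ge_min lexx orbT.
move=> i; rewrite inE => /predU1P[->|si].
  have := ler_norm (G j); nra.
have := eP i si; have := F0 i; rewrite inE si orbT => /(_ isT) Fi.
by have [Gi|Gi] := leP (G i) 0; nra.
Qed.

(** Tilting [w] slightly towards [v b] makes it positive there and keeps it positive on [S]. *)
Lemma pos_add S w b : (forall i, i \in S -> 0 < dot w (v i)) ->
  0 <= dot w (v b) -> v b != 0 -> pos (b |: S).
Proof.
move=> wS wb b0.
have [e e0 eP] := small_scaling (fun i => - dot (v b) (v i)) wS.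
exists (w + e *: v b) => i; rewrite dotDl dotZl => /setU1P[->|iS].
  by rewrite ltr_wpDl // mulr_gt0 // dot_self_gt0.
by have := eP i iS; lra.
Qed.

(* Gordan's alternative in the plane, with Caratheodory's bound on the number of points. *)
Lemma pos_or_triple S : pos S \/
  exists i j k (l m n : R), [/\ i \in S, j \in S & k \in S] /\
    [/\ 0 <= l, 0 <= m, 0 <= n, 0 < l + m + n &
      l *: v i + m *: v j + n *: v k = 0].
Proof.
have [N] := ubnP #|S|; elim: N S => // N IHN S.
have [->|[b bS] SN] := set_0Vmem S.
  by move=> _; left; exists 0 => i; rewrite inE.
have [|[w wS]|[i [j [k [l [m [n [[iS jS kS] H]]]]]]]] := IHN (S :\ b); first 1 last.
- have [b0|b0] := eqVneq (v b) 0.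
    right; exists b, b, b, 1, 1, 1; split => //; split; rewrite ?ler01 //.
    by rewrite b0 !scaler0 !addr0.
  have [fb|fb] := leP 0 (dot w (v b)).
    by left; rewrite -(finset.setD1K bS); apply: pos_add wS fb b0.
  (* [g] is the determinant with [v b]. If it has constant strict sign off [b], then [perp (v b)] or
     its opposite, tilted by [pos_add], is positive on [S]. *)
  pose g i := dot (perp (v b)) (v i).
  have gb : g b = 0 by rewrite /g dot_perp; ring.
  have [g0|[c cS gc]] : (forall i, i \in S :\ b -> 0 < g i) \/
      exists2 c, c \in S :\ b & g c <= 0.
    apply: contrapT => /not_orP[H1 H2]; apply: H1 => i iS.
    by rewrite ltNge; apply/negP => gi; apply: H2; exists i.
  + left; rewrite -(finset.setD1K bS); apply: pos_add g0 _ b0.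
    by rewrite -/(g b) gb.
  have [g0|[d dS gd]] : (forall i, i \in S :\ b -> g i < 0) \/
      exists2 c, c \in S :\ b & 0 <= g c.
    apply: contrapT => /not_orP[H1 H2]; apply: H1 => i iS.
    by rewrite ltNge; apply/negP => gi; apply: H2; exists i.
  + left; rewrite -(finset.setD1K bS).
    apply: (@pos_add _ (- perp (v b))) => // [i iS|].
      by rewrite dotNl oppr_gt0 g0.
    by rewrite dotNl -/(g b) gb oppr0.
  have wc := wS _ cS; have wd := wS _ dS.
  have [_ cS'] := setD1P cS; have [_ dS'] := setD1P dS.
  (* In the degenerate case [v c] lies on the line of [v b], and [w] shows that they point in
     opposite directions. *)
  right; have [/andP[/eqP gc0 /eqP gd0]|gcd] := boolP ((g c == 0) && (g d == 0)).
    exists c, b, b, (- dot w (v b)), (dot w (v c)), 0; split => //.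
    split; [lra|lra|lra|lra|].
    move: gc0; rewrite /g dot_perp /dot => gc0.
    apply: row2P; rewrite !mxE.
      by rewrite -[RHS](mulr0 (w 0 1)) -[in RHS]gc0; ring.
    by rewrite -[RHS](mulr0 (- w 0 0)) -[in RHS]gc0; ring.
  (* Cramer coefficients of the linear relation among three plane vectors; [key] fixes the sign of
     the last one. *)
  exists c, d, b, (g d), (- g c), (v d 0 0 * v c 0 1 - v d 0 1 * v c 0 0).
  have key : (v d 0 0 * v c 0 1 - v d 0 1 * v c 0 0) * (- dot w (v b)) =
      g d * dot w (v c) - g c * dot w (v d).
    by rewrite /g !dot_perp /dot; ring.
  have h : 0 <= v d 0 0 * v c 0 1 - v d 0 1 * v c 0 0.
    rewrite -(pmulr_lge0 _ (_ : 0 < - dot w (v b))) ?oppr_gt0 // key.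
    by nra.
  split => //; split => //; first by rewrite oppr_ge0.
    rewrite ltr_pwDl //; rewrite lt_neqAle subr_ge0 (le_trans gc gd) andbT.
    apply: contraNN gcd; rewrite eq_sym subr_eq0 => /eqP E.
    by apply/andP; split; apply/eqP; lra.
  by apply: row2P; rewrite /g !dot_perp !mxE; ring.
- right; exists i, j, k, l, m, n; split => //.
  by move: iS jS kS => /setD1P[_ ?] /setD1P[_ ?] /setD1P[_ ?].
- by move: SN; rewrite (cardsD1 b) bS.
Qed.

Lemma triple_not_pos S i j k (l m n : R) :
  i \in S -> j \in S -> k \in S -> 0 <= l -> 0 <= m -> 0 <= n ->
  0 < l + m + n -> l *: v i + m *: v j + n *: v k = 0 -> ~ pos S.
Proof.
move=> iS jS kS l0 m0 n0 lmn E [w wS].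
have := congr1 (dot w) E; rewrite !dotDr !dotZr dot0r.
have wi := wS i iS; have wj := wS j jS; have wk := wS k kS.
have hi := mulr_ge0 l0 (ltW wi); have hj := mulr_ge0 m0 (ltW wj).
have hk := mulr_ge0 n0 (ltW wk).
have [/mulr_gt0/(_ wi)|l_le0] := ltP 0 l; first lra.
have [/mulr_gt0/(_ wj)|m_le0] := ltP 0 m; first lra.
have [/mulr_gt0/(_ wk)|n_le0] := ltP 0 n; lra.
Qed.

(** * Slopes and partitions around the origin *)

Section Slopes.
Variables w z : 'rV[R]_2.
Let f i := dot w (v i).
Let s i := dot z (v i) / f i.

(** Otherwise every point of [Y] with [f i > 0] has slope above [u], and [z - (u + e) w] is positive
    on [Y] for small [e > 0]. *)
Lemma exists_low_slope Y (u : R) : ~ pos Y -> (forall i, i \in Y -> f i != 0) ->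
  (forall i, i \in Y -> f i < 0 -> s i <= u) ->
  exists i, [/\ i \in Y, 0 < f i & s i <= u].
Proof.
move=> nY f0 su; apply: contrapT => H; apply: nY.
have H' i : i \in [set i in Y | 0 < f i]%SET -> 0 < s i - u.
  rewrite inE => /andP[iY fi]; rewrite subr_gt0 ltNge; apply/negP => si.
  by apply: H; exists i.
have [e e0 eP] := small_scaling (fun=> 1) H'.
exists (z - (u + e) *: w) => i iY; rewrite dotDl dotNl dotZl.
have -> : dot z (v i) = s i * f i by rewrite divfK // f0.
rewrite -/(f i) -mulrBl; have [fi|fi|fi] := ltgtP (f i) 0.
- by rewrite nmulr_lgt0 //; have := su i iY fi; lra.
- by rewrite pmulr_lgt0 //; have := eP i; rewrite inE iY fi => /(_ isT); lra.
- by have := f0 i iY; rewrite fi eqxx.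
Qed.

End Slopes.

(** By [dot_decomp], a functional positive on [S] would give an affine function of the slope that is
    positive at [s a] and [s c] but negative at [s b] between them. *)
Lemma between_not_pos S w a b c (s := fun i => dot (perp w) (v i) / dot w (v i)) :
  a \in S -> b \in S -> c \in S ->
  0 < dot w (v a) -> dot w (v b) < 0 -> 0 < dot w (v c) ->
  s a <= s b -> s b <= s c -> ~ pos S.
Proof.
move=> aS bS cS fa fb fc sab sbc [u uS].
have ww : 0 < dot w w.
  apply: dot_self_gt0; apply: contraTneq fa => ->.
  by rewrite /dot !mxE !mul0r addr0 ltxx.
have us i : i \in S -> dot w (v i) != 0 ->
    0 < (dot u w + dot u (perp w) * s i) * dot w (v i).
  move=> iS fi; rewrite mulrDl -mulrA divfK // -dot_decomp mulr_gt0 //.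
  exact: uS.
have := us a aS (lt0r_neq0 fa); rewrite pmulr_lgt0 // => ha.
have := us c cS (lt0r_neq0 fc); rewrite pmulr_lgt0 // => hc.
have := us b bS (ltr0_neq0 fb); rewrite nmulr_lgt0 // => hb.
by have [?|?] := leP 0 (dot u (perp w)); nra.
Qed.

(** Only [a] and [b] lie beyond the line [w = 0]. A triangle with vertex [a] and two points of the
    other side contains the origin when their slopes enclose that of [a], and likewise for [b]; two
    disjoint enclosing pairs are sought. *)
Lemma depth_two_split_pair w a b : #|T| != 5%N ->
  (forall i, v i != 0) -> (forall i, ~ pos [set~ i]) ->
  (forall i, i \notin [set a; b] -> 0 < dot w (v i)) ->
  exists B C, [/\ [disjoint B & C], ~ pos B & ~ pos C].
Proof.
move=> T5 v0 H wD.
pose f i := dot w (v i); pose s i := dot (perp w) (v i) / f i.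
wlog sab : a b wD / s a <= s b.
  move=> IH; have [sab|/ltW sba] := leP (s a) (s b); first exact: (IH a b).
  by apply: (IH b a) => // i; rewrite finset.setUC; apply: wD.
set D := ~: [set a; b]; have fD i : i \in D -> 0 < f i by rewrite inE; apply: wD.
have ab : a != b.
  apply/eqP => ab; apply: (H a); exists w => i.
  by rewrite !inE => ia; apply: wD; rewrite !inE -ab orbb.
(* If [f c >= 0], then [c] can join [D], so that all points but [d] admit a positive functional,
   against [H]. *)
have neg_of c d : [set a; b] = [set c; d] -> f c < 0.
  move=> abcd; rewrite ltNge; apply/negP => fc.
  apply: (H d); apply: (@pos_sub _ (c |: D)).
    apply/fintype.subsetP => i; rewrite /D abcd !inE negb_or => ->.
    by rewrite andbT orbN.
  by apply: (pos_add (w := w)).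
have fa : f a < 0 by apply: (neg_of a b).
have fb : f b < 0 by apply: (neg_of b a); rewrite finset.setUC.
have f0 i : f i != 0.
  have [iD|] := boolP (i \in D); first exact/lt0r_neq0/fD.
  by rewrite !inE negbK => /orP[] /eqP ->; apply: ltr0_neq0.
have fpos i : 0 < f i -> i \in D.
  by move=> fi; rewrite !inE; apply/norP; split; apply: contraTneq fi => ->;
    rewrite -leNgt ltW.
(* Only [a] and [b] have negative [f]: the slope bound is checked at them alone, and the point found
   lies in [D]. *)
have low Y (u : R) : ~ pos Y -> (forall i, i \in Y -> i \in [set a; b] -> s i <= u) ->
    exists2 i, i \in Y :&: D & s i <= u.
  move=> nY su; have [|i iY fi|i [iY fi si]] := exists_low_slope (w := w) (z := perp w) (u := u) nY.
  - by move=> i _; apply: f0.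
  - by apply: su => //; apply/negPn/negP => /wD; rewrite ltNge ltW.
  - by exists i => //; apply/finset.setIP; split=> //; apply: fpos.
have high Y (u : R) : ~ pos Y -> (forall i, i \in Y -> i \in [set a; b] -> u <= s i) ->
    exists2 i, i \in Y :&: D & u <= s i.
  move=> nY su.
  have [|i iY fi|i [iY fi si]] := exists_low_slope (w := w) (z := - perp w) (u := - u) nY.
  - by move=> i _; apply: f0.
  - rewrite dotNl mulNr lerN2; apply: su => //.
    by apply/negPn/negP => /wD; rewrite ltNge ltW.
  - exists i; first by apply/finset.setIP; split=> //; apply: fpos.
    by move: si; rewrite dotNl mulNr lerN2.
have [x0 /finset.setIP[_ x0D] sx0] : exists2 i, i \in [set~ b] :&: D & s i <= s a.
  apply: low => // i; rewrite !inE => /negbTE ->; rewrite orbF => /eqP ->; exact: lexx.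
have [z0 /finset.setIP[_ z0D] sz0] : exists2 i, i \in [set~ a] :&: D & s b <= s i.
  apply: high => // i; rewrite !inE => /negbTE -> /= /eqP ->; exact: lexx.
pose x := [arg min_(i < x0 in D) s i]%O.
have [xD xmin] : x \in D /\ forall i, i \in D -> s x <= s i.
  by rewrite /x; case: arg_minP.
have sxa : s x <= s a by apply: le_trans (xmin _ x0D) sx0.
(* Omitting [x] keeps both [a] and [b], so a second point of [D] has slope at most [s b], the larger
   of the two. *)
have [y /finset.setIP[yx yD] sy] : exists2 i, i \in [set~ x] :&: D & s i <= s b.
  by apply: low => // i _; rewrite !inE => /orP[] /eqP ->.
have yDx : y \in D :\ x by apply/setD1P; split=> //; move: yx; rewrite in_setC1.
pose z := [arg max_(i > y in D :\ x) s i]%O.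
have [zDx zmax] : z \in D :\ x /\ forall i, i \in D :\ x -> s i <= s z.
  by rewrite /z; case: arg_maxP.
have [zx zD] := setD1P zDx.
have sbz : s b <= s z.
  have [z0x|z0x] := eqVneq z0 x; last by apply: le_trans sz0 (zmax _ _); apply/setD1P.
  by apply: le_trans sz0 _; rewrite z0x xmin.
have [y' /finset.setIP[y'z y'D] sy'] : exists2 i, i \in [set~ z] :&: D & s a <= s i.
  by apply: high => // i _; rewrite !inE => /orP[] /eqP ->.
rewrite in_setC1 in yx; rewrite in_setC1 in y'z.
(* [p = z] and [q = x] are allowed: this is how the case #|T| = 4 is settled. *)
have split_by p q : p \in D -> q \in D -> p != x -> q != z -> p != q ->
    s p <= s b -> s a <= s q ->
    exists B C, [/\ [disjoint B & C], ~ pos B & ~ pos C].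
  (* The slope of [a] lies between those of [x] and [q], that of [b] between those of [p] and
     [z]. *)
  move=> pD qD px qz pq spb saq; exists [set x; a; q], [set p; b; z]; split.
  - have nab c : c \in D -> (c != a) && (c != b) by rewrite !inE negb_or.
    have /andP[xa xb] := nab x xD; have /andP[za zb] := nab z zD.
    have /andP[pa pb] := nab p pD; have /andP[qa qb] := nab q qD.
    apply/pred0P => i /=; rewrite !inE; apply/negP.
    move=> /andP[/orP[/orP[]|] /eqP -> /orP[/orP[]|] /eqP e];
      move: px qz pq zx ab xa xb za zb pa pb qa qb; rewrite e ?eqxx //.
  - by apply: (between_not_pos (w := w) (a := x) (b := a) (c := q));
      rewrite ?inE ?eqxx ?orbT //; apply: fD.
  - by apply: (between_not_pos (w := w) (a := p) (b := b) (c := z));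
      rewrite ?inE ?eqxx ?orbT //; apply: fD.
have [E0|[e eE]] := set_0Vmem (D :\ x :\ z).
  have yz : y = z.
    by apply/eqP; apply: contraT => yz; have : y \in D :\ x :\ z;
      [apply/setD1P | rewrite E0 inE].
  have y'x : y' = x.
    by apply/eqP; apply: contraT => y'x; have : y' \in D :\ x :\ z;
      [apply/setD1P; split=> //; apply/setD1P | rewrite E0 inE].
  by apply: (split_by z x); rewrite // ?(eq_sym x) // -?y'x // -yz.
pose p := [arg min_(i < e in D :\ x :\ z) s i]%O.
have [pE pmin] : p \in D :\ x :\ z /\ forall i, i \in D :\ x :\ z -> s p <= s i.
  by rewrite /p; case: arg_minP.
have [pz /setD1P[px pD]] := setD1P pE.
(* Nothing remains besides [x], [z], [p] in [D] exactly in the excluded case [#|T| = 5]. *)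
have cardT : #|T| = (#|D :\ x :\ z :\ p|.+2.+3)%N.
  rewrite -(cardsC [set a; b]) cards2 ab -/D (cardsD1 x) xD (cardsD1 z) zDx.
  by rewrite (cardsD1 p) pE.
have [E0|[e' e'E]] := set_0Vmem (D :\ x :\ z :\ p).
  by move: T5; rewrite cardT E0 cards0.
pose q := [arg max_(i > e' in D :\ x :\ z :\ p) s i]%O.
have [qE qmax] : q \in D :\ x :\ z :\ p /\
    forall i, i \in D :\ x :\ z :\ p -> s i <= s q.
  by rewrite /q; case: arg_maxP.
have [qp /setD1P[qz qDx]] := setD1P qE; have [_ qD] := setD1P qDx.
(* By extremality [p] and [q] inherit the bounds of [y] and [y']; if [y] is [z], or [y'] is [x] or
   [p], the order of the slopes gives them. *)
apply: (split_by p q); rewrite // ?(eq_sym p) //.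
  have [yz|yz] := eqVneq y z.
    by apply: le_trans sy; rewrite yz zmax //; apply/setD1P.
  by apply: le_trans sy; apply: pmin; apply/setD1P.
have [y'x|y'x] := eqVneq y' x.
  by apply: le_trans sy' _; rewrite y'x xmin.
have y'E : y' \in D :\ x :\ z by apply/setD1P; split=> //; apply/setD1P.
have [y'p|y'p] := eqVneq y' p; last by apply: le_trans sy' (qmax _ _); apply/setD1P.
by apply: le_trans sy' _; rewrite y'p pmin //; case/setD1P: qE.
Qed.

Lemma depth_two_partition : (0 < #|T|)%N -> #|T| != 5%N ->
  (forall i, ~ pos [set~ i]) ->
  exists B C, [/\ [disjoint B & C], ~ pos B & ~ pos C].
Proof.
move=> T0 T5 H.
have [[i0 vi0]|v0] := pselect (exists i, v i = 0).
  exists [set i0], [set~ i0]; split => //; first by rewrite disjoints1 !inE eqxx.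
  by case=> w /(_ i0); rewrite inE eqxx vi0 dot0r ltxx => /(_ isT).
have {}v0 i : v i != 0 by apply/eqP => vi; apply: v0; exists i.
have [[a [b [w wD]]]|H2] := pselect (exists a b, pos (~: [set a; b])).
  apply: (depth_two_split_pair (w := w) (a := a) (b := b)) => // i iab.
  by apply: wD; rewrite inE.
have [posT|[i [j [k [l [m [n [_ [l0 m0 n0 lmn E]]]]]]]]] := pos_or_triple [set: T].
  by have /card_gt0P[i _] := T0; case: (H i); apply: pos_sub posT; apply: finset.subsetT.
pose B := [set i; j; k].
have nB : ~ pos B.
  by apply: (triple_not_pos (i := i) (j := j) (k := k)) E; rewrite ?inE ?eqxx ?orbT.
exists B, (~: B); split => //; first by rewrite -setI_eq0 finset.setICr.
(* A [w] positive off [B] is negative on [B]: a point of [B] with nonnegative value could be added,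
   leaving at most two points outside, against [H2]. *)
move=> [w wC]; apply: nB; exists (- w).
have neg_of c d e : B = [set c; d; e] -> dot w (v c) < 0.
  move=> Bcde; rewrite ltNge; apply/negP => fc; apply: H2; exists d, e.
  apply: (@pos_sub _ (c |: ~: B)); last exact: pos_add wC fc (v0 c).
  apply/fintype.subsetP => t; rewrite Bcde !inE !negb_or => /andP[-> ->].
  by rewrite !andbT orbN.
move=> t; rewrite dotNl oppr_gt0 !inE => /orP[/orP[]|] /eqP ->.
- exact: (neg_of i j k).
- by apply: (neg_of j i k); apply/finset.setP => t'; rewrite !inE; do !case: eqP.
- by apply: (neg_of k i j); apply/finset.setP => t'; rewrite !inE; do !case: eqP.
Qed.

End Family.
End PlaneVectors.

Local Open Scope classical_set_scope.

(** * Convex hulls and positive functionals *)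

Section ConvexHull.
Local Open Scope ring_scope.
Context {R : realType}.
Implicit Types (A K : set 'rV[R]_2) (x y p : 'rV[R]_2).

Lemma convex_setP K : @convex_set R 'rV[R]_2 K <->
  forall x y (t : R), 0 <= t -> t <= 1 -> K x -> K y -> K (t *: x + (1 - t) *: y).
Proof.
split=> [cK x y t t0 t1 Kx Ky|cK x y t /set_mem Kx /set_mem Ky].
  by have /set_mem := cK x y (Itv01 t0 t1) (mem_set Kx) (mem_set Ky).
exact/mem_set/cK.
Qed.

Lemma convex_hull_convex A : @convex_set R 'rV[R]_2 (convex_hull A).
Proof.
apply/convex_setP => x y t t0 t1 hx hy K [/[dup] cK /convex_setP cK' AK].
by apply: cK' => //; [apply: hx|apply: hy].
Qed.

Lemma convex_set_mean K x y (l m : R) : @convex_set R 'rV[R]_2 K ->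
  K x -> K y -> 0 <= l -> 0 <= m -> 0 < l + m ->
  K ((l + m)^-1 *: (l *: x + m *: y)).
Proof.
move=> /convex_setP cK Kx Ky l0 m0 lm.
have -> : (l + m)^-1 *: (l *: x + m *: y) =
    (l / (l + m)) *: x + (1 - l / (l + m)) *: y.
  rewrite scalerDr !scalerA mulrC; congr (_ + _ *: _).
  by field; apply: lt0r_neq0.
apply: cK => //; first by rewrite divr_ge0 // ltW.
by rewrite ler_pdivrMr // mul1r lerDl.
Qed.

(** Gordan's alternative read at [p]: a positive functional gives an open half-plane containing the
    hull but not [p], while a Caratheodory triple writes [p] as a convex combination. *)
Lemma convex_hull_posP (T : finType) (a : T -> 'rV[R]_2) (S : {set T}) p :
  convex_hull (a @` [set i | i \in S]) p <-> ~ pos (fun i => a i - p) S.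
Proof.
split=> [hp [w wS]|].
  have : [set q | 0 < dot w (q - p)] p.
    apply: hp; split=> [|_ [i iS <-]]; last exact: wS.
    apply/convex_setP => x y t t0 t1 /= hx hy.
    have -> : t *: x + (1 - t) *: y - p = t *: (x - p) + (1 - t) *: (y - p).
      by apply: row2P; rewrite !mxE; ring.
    rewrite dotDr !dotZr; have [->|t0'] := eqVneq t 0; first by rewrite mul0r add0r subr0 mul1r.
    have t0'' : 0 < t by rewrite lt_neqAle eq_sym t0'.
    by rewrite ltr_pwDl ?mulr_gt0 // mulr_ge0 ?subr_ge0 // ltW.
  by rewrite /= subrr dot0r ltxx.
have [//|[i [j [k [l [m [n [[iS jS kS] [l0 m0 n0 lmn E]]]]]]]] _] := pos_or_triple (fun i => a i - p) S.
have hull t : t \in S -> convex_hull (a @` [set i | i \in S]) (a t).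
  by move=> tS; apply: sub_smallest (fun x h => h) _ _; exists t.
have cH := @convex_hull_convex (a @` [set i | i \in S]).
have Ep : (l + m + n) *: p = l *: a i + m *: a j + n *: a k.
  by apply/eqP; rewrite -subr_eq0 -oppr_eq0 -[X in _ == X]E; apply/eqP/row2P; rewrite !mxE; ring.
(* The iterated mean first divides by [l + m]; if this is 0, then [p] is [a k]. *)
have [lm0|lm] := leP (l + m) 0.
  have [l00 m00] : l = 0 /\ m = 0 by split; lra.
  move: Ep lmn; rewrite l00 m00 !scale0r !add0r => Ep n_gt0.
  by rewrite (scalerI (lt0r_neq0 n_gt0) Ep); apply: hull.
have := convex_set_mean cH (convex_set_mean cH (hull i iS) (hull j jS) l0 m0 lm)
  (hull k kS) (ltW lm) n0 lmn.
by rewrite scalerA divff ?lt0r_neq0 // scale1r -Ep scalerA mulVf ?lt0r_neq0 // scale1r.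
Qed.

End ConvexHull.

Lemma card_le_ordP (T : Type) (A : set T) (r : nat) :
  (`I_r #<= A)%card <->
  exists2 a : 'I_r -> T, (forall i, A (a i)) & injective a.
Proof.
have -> : (`I_r #<= A)%card = ([set: 'I_r] #<= A)%card.
  by rewrite (card_le_eql card_II).
split=> [/card_leP/injfunPex[f _ f_inj]|[a aA a_inj]].
  exists (fun i => sval (f (exist _ i (mem_set I)))) => [i|i j ij].
    exact/set_mem/(svalP (f _)).
  have /f_inj : f (exist _ i (mem_set I)) = f (exist _ j (mem_set I)).
    exact: val_inj.
  by move=> /(_ (mem_set I) (mem_set I))/(congr1 sval).
apply/card_leP/injfunPex.
exists (fun s => exist _ (a (sval s)) (mem_set (aA (sval s)))) => // s t _ _.
by move=> /(congr1 sval)/a_inj st; apply: val_inj.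
Qed.

Lemma exists_notin (T : finType) (J : {set T}) : #|J| < #|T| ->
  exists i, i \notin J.
Proof.
move=> JT; apply/existsP; rewrite -negb_forall; apply: contraL JT => /forallP JT.
by rewrite -leqNgt -cardsT; apply/subset_leq_card/fintype.subsetP => i _.
Qed.

(** * Comparing the Helly and Radon properties *)

Section HellyRadonNumbers.
Context {R : realType}.
Implicit Types M A B C K : set 'rV[R]_2.

(** Since [h < m], a subfamily of [h] indices extends by one. This lets the case 4 fall back on
    5. *)
Lemma helly_propertyS M h : helly_property M h -> helly_property M h.+1.
Proof.
move=> HM m C hm MC CJ; apply: HM (ltnW hm) MC _ => J Jh.
have [i iJ] : exists i, i \notin J by apply: exists_notin; rewrite Jh card_ord.
have [|p [Mp Cp]] := CJ (i |: J)%SET; first by rewrite cardsU1 iJ Jh.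
exists p; split=> // j jJ; apply: Cp => /=; apply/setU1r; exact: jJ.
Qed.

Lemma radon_property0 M : ~ radon_property M 0.
Proof.
move=> /(_ set0)[//||B [C [B0 _ _ [p [[_ hp] _]]]]]; first by rewrite II0 card_ge0.
suff : set0 p by [].
apply: hp; split=> //; apply/convex_setP => x y t _ _ [].
Qed.

Lemma convex_hull_sub A K : @convex_set R 'rV[R]_2 K -> A `<=` K ->
  convex_hull A `<=` K.
Proof. by move=> cK AK p; apply. Qed.

(** Levi's argument, by induction on the size of a subfamily: for each index choose a point in all
    the other sets, then split these points by the Radon property. *)
Lemma radon_helly M h : radon_property M h.+1 -> helly_property M h.
Proof.
move=> RM m C hm MC CJ.
suff H : forall J : {set 'I_m}, (h <= #|J|)%N ->
    M `&` \bigcap_(i in [set i | i \in J]) C i !=set0.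
  have [|p [Mp Cp]] := H [set: 'I_m]%SET; first by rewrite cardsT card_ord.
  by exists p; split=> // i _; apply: Cp; rewrite /= finset.in_setT.
move=> J; have [N] := ubnP #|J|; elim: N J => // N IHN J.
rewrite ltnS => JN; rewrite leq_eqVlt => /predU1P[hJ|hJ]; first by apply: CJ.
(* Outside [J] the value 0 is a dummy. *)
have /choice[x xP] : forall i, exists x, i \in J ->
    M x /\ forall j, j \in J -> j != i -> C j x.
  move=> i; have [iJ|_] := boolP (i \in J); last by exists 0%R.
  have JiN : (#|J| = #|(J :\ i)%SET|.+1)%N by rewrite (cardsD1 i) iJ.
  have [||x [Mx Cx]] := IHN (J :\ i)%SET; [by rewrite -JiN|by rewrite -ltnS -JiN|].
  exists x => _; split=> // j jJ ji; apply: Cx; rewrite /= in_setD1 ji; exact: jJ.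
(* The Radon property concerns sets, so coincidences come first: a repeated point already lies in
   every [C k] with [k] in [J]. *)
have [[i [j [iJ jJ ij xij]]]|x_inj] := pselect (exists i j,
    [/\ i \in J, j \in J, i != j & x i = x j]).
  have [Mx Cx] := xP i iJ; exists (x i); split=> // k kJ.
  have [ki|ki] := eqVneq k i; last exact: Cx.
  by rewrite ki xij; have [_] := xP j jJ; apply.
have [_ [i iJ <-]||B [B' [BA B'A BB' [p [[Mp Bp] B'p]]]]] :=
  RM (x @` [set i | i \in J]); first by have [] := xP i iJ.
  apply/card_le_ordP; exists (fun k => x (enum_val (widen_ord hJ k))) => [k|k l E].
    by exists (enum_val (widen_ord hJ k)) => //; apply: enum_valP.
  apply/val_inj; have [/enum_val_inj/(congr1 val)//|kl] :=
    eqVneq (enum_val (widen_ord hJ k)) (enum_val (widen_ord hJ l)).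
  by case: x_inj; exists (enum_val (widen_ord hJ k)), (enum_val (widen_ord hJ l));
    split=> //; apply: enum_valP.
exists p; split=> // i iJ.
have [K [cK CK]] := MC i.
(* A part omitting [x i] consists of points of [C i]; of two disjoint parts, at least one omits
   [x i]. *)
have inK D : D `<=` x @` [set i | i \in J] -> ~ D (x i) -> D `<=` K.
  move=> DA Dx q Dq; have [j jJ xj] := DA q Dq.
  have [_ /(_ i iJ)] := xP j jJ; rewrite CK xj.
  have [ij|_ /(_ isT)[]//] := eqVneq i j.
  by case: Dx; rewrite ij xj.
rewrite CK; split=> //; have [Bx|Bx] := pselect (B (x i)).
  apply: (convex_hull_sub cK (inK B' B'A _)) => // B'x.
  by have : (B `&` B') (x i) by []; rewrite BB'.
exact: (convex_hull_sub cK (inK B BA Bx)).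
Qed.

Lemma helly_radon M h : h != 4 -> helly_property M h -> radon_property M h.+1.
Proof.
move=> h4 HM A AM /card_le_ordP[a aA a_inj].
pose C (i : 'I_h.+1) := M `&` convex_hull (a @` [set j | j \in [set~ i]%SET]).
have [|i|J Jh|p [Mp Cp]] := HM h.+1 C; first exact: leqnSn.
- by exists (convex_hull (a @` [set j | j \in [set~ i]%SET])); split=> //;
    apply: convex_hull_convex.
(* For [i] outside [J], the point [a i] belongs to [C j] for every [j] in [J]. *)
- have [i iJ] : exists i, i \notin J by apply: exists_notin; rewrite Jh card_ord.
  exists (a i); split; [exact/AM/aA|move=> j jJ; split; first exact/AM/aA].
  apply: sub_smallest (fun x h => h) _ _; exists i => //=.
  by rewrite in_setC1; apply: contraNneq iJ => ->.
have [||i|B [C' [/pred0P BC nB nC]]] :=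
  @depth_two_partition _ _ (fun i => a i - p)%R.
- by rewrite card_ord.
- by rewrite card_ord.
- by apply/convex_hull_posP; have [] := Cp i I.
exists (a @` [set i | i \in B]), (a @` [set i | i \in C']); split.
- by move=> _ [i _ <-]; apply: aA.
- by move=> _ [i _ <-]; apply: aA.
- rewrite -subset0 => _ [[i iB <-] [j jC /a_inj ji]].
  by have := BC i; rewrite /= iB -ji jC.
- by exists p; split; [split=> //|]; apply/convex_hull_posP.
Qed.

End HellyRadonNumbers.

Theorem theorem1p6 (R : realType) (M : set 'rV[R]_2) (M_neq0 : M !=set0) :
  (helly_number M <> Some 4 -> radon_number M = omap succn (helly_number M)) /\
  (helly_number M = Some 4 ->
     radon_number M = Some 5 \/ radon_number M = Some 6).
Proof.
(* The Radon property holds only at successors, so its candidates [h.+1] match Helly candidates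
   [h]. *)
have radon_pos r : radon_property M r -> exists2 h, r = h.+1 & helly_property M h.
  by case: r => [/radon_property0//|h /radon_helly]; exists h.
split=> [|/nat_minP[H4 min4]].
  case E : (helly_number M) => [h|] /= h4.
    have [Hh minh] := (nat_minP _ _).1 E; apply/nat_minP; split.
      by apply: helly_radon => //; apply/eqP => h4'; apply: h4; rewrite h4'.
    by move=> r /radon_pos[k -> /minh].
  apply/nat_min_None => r /radon_pos[k _]; exact: (nat_min_None _).1 E k.
(* Passing from 4 to 5 avoids the exceptional value, whence the upper bound 6. *)
have R6 : radon_property M 6 by apply: helly_radon => //; apply: helly_propertyS.
have ge5 r : radon_property M r -> 5 <= r by move=> /radon_pos[k -> /min4].
have [R5|nR5] := pselect (radon_property M 5); [left|right]; apply/nat_minP; split=> //.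
move=> r Rr; rewrite ltn_neqAle ge5 // andbT.
by apply/eqP => r5; apply: nR5; rewrite r5.
Qed.
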